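(* Let $X$ be a Baire space, let $T$ be a set, let $Y\subseteq\mathbb R^T$ be a compact space, and let $f:X\times Y\to\mathbb R$ be a separately continuous function which is Baire measurable. Then $f$ has the Namioka property, i.e. there exists a dense $G_\delta$-set $A\subseteq X$ such that $f$ is jointly continuous at every point of $A\times Y$.
   Context: $\mathbb R^T$ carries the product topology and $Y$ the subspace topology. A topological space is Baire if every countable intersection of dense open sets is dense. A function $f:X\times Y\to\mathbb R$ is separately continuous if it is continuous in each variable when the other is fixed. For a topological space $P$, a function $f:P\to\mathbb R$ is of Baire class $0$ if it is continuous, and for an at most countable ordinal $\alpha\ge 1$ it is of Baire class $\alpha$ if there is a sequence of functions $f_n:P\to\mathbb R$, each of Baire class $<\alpha$, with $f(p)=\lim_{n\to\infty}f_n(p)$ for every $p\in P$. The function $f$ is Baire measurable if it is of Baire class $\alpha$ for some at most countable ordinal $\alpha$. Here Baire measurability of $f$ refers to the product topology on $P=X\times Y$. *)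

(* Defs.v *)
From HB Require Import structures.
From mathcomp Require Import all_boot all_order all_algebra.
From mathcomp Require Import all_classical all_reals all_analysis.
From mathcomp Require Import wochoice borel_hierarchy.

Set Implicit Arguments.
Unset Strict Implicit.
Unset Printing Implicit Defensive.

Import Order.TTheory GRing.Theory Num.Theory.
Import numFieldNormedType.Exports.

Local Open Scope classical_set_scope.
Local Open Scope ring_scope.

Definition baire_space (X : topologicalType) : Prop :=
  forall U : (set X)^nat, (forall n, open (U n)) -> (forall n, dense (U n)) ->
    dense (\bigcap_n U n).

(* An ordinal is represented by an element [a] of a well-ordered type [I]: it
   stands for the order type of [{b | b < a}].  Thus the least element of [I]
   represents 0, and the ordinals below [a] are the ones represented by the
   [b < a]. *)
Inductive baire_class (R : realType) (P : topologicalType)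
    (d : Order.disp_t) (I : orderType d) : I -> (P -> R) -> Prop :=
| baire_class_continuous (a : I) (f : P -> R) :
    (forall b : I, ~ (b < a)%O) -> continuous f -> baire_class a f
| baire_class_lim (a : I) (f : P -> R) (b : nat -> I) (g : nat -> P -> R) :
    (forall n, (b n < a)%O) -> (forall n, baire_class (b n) (g n)) ->
    (forall p, g n p @[n --> \oo] --> f p) -> baire_class a f.

Definition baire_measurable (R : realType) (P : topologicalType)
    (f : P -> R) : Prop :=
  exists (d : Order.disp_t) (I : orderType d) (a : I),
    [/\ well_order (fun x y : I => (x <= y)%O),
        countable [set b : I | (b < a)%O]
      & baire_class a f].

Definition separately_continuous (X Y Z : topologicalType) (f : X * Y -> Z)
    : Prop :=
  (forall x : X, continuous (fun y : Y => f (x, y))) /\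
  (forall y : Y, continuous (fun x : X => f (x, y))).

Definition namioka_property (X Y Z : topologicalType) (f : X * Y -> Z)
    : Prop :=
  exists A : set X, [/\ dense A, Gdelta A
    & forall (x : X) (y : Y), A x -> {for (x, y), continuous f}].

(* Main.v *)
Require Import Defs.
From mathcomp Require Import all_boot all_order all_algebra.
From mathcomp Require Import all_classical all_reals all_analysis.
From mathcomp Require Import lra.

Import Order.TTheory GRing.Theory Num.Theory.
Import numFieldNormedType.Exports.

Local Open Scope classical_set_scope.
Local Open Scope ring_scope.

(** A Baire measurable function [f] on [X * Y] is determined by countably many
    jointly continuous functions [g k]: if all the [g k] agree at [p] and [q]
    then so does [f] ([baire_class_determined], by induction on the Baire
    class).

    Fix [e > 0], and let [F n] be the set of the [x] for which any two points
    [y], [y'] whose values [g k (x, y)], [g k (x, y')] differ by less than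
    [1 / (n + 1)] for all [k <= n] satisfy [|f (x, y) - f (x, y')| <= e].
    - [F n] is closed, because [f] and the [g k] are continuous in [x]
      ([closed_controlled]).
    - The [F n] cover [X]: for a fixed [x] the continuous function [f (x, _)]
      factors through the sequence of the [g k (x, _)], and by compactness of
      [Y] the factorization is uniformly continuous ([bigcup_controlled]).
    Since [X] is Baire, the interiors of the [F n] have a dense union
    ([dense_bigcup_interior]), and the intersection [A] of these unions over
    the [e = 1 / (m + 1)] is a dense G-delta set.

    Now let [x0] be interior to [F n].  By joint continuity of the [g k],
    every [(x, y)] close to [(x0, y0)] has [g k (x, y)] close to
    [g k (x, y0)] for all [k <= n], so [f (x, y)] is within [e] of
    [f (x, y0)], which in turn tends to [f (x0, y0)] as [x] tends to [x0].
    Hence [f] is jointly continuous at the points of [A * Y]. *)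

Lemma compact_set_type (Z : topologicalType) (Y : set Z) :
  compact Y -> compact [set: set_type Y].
Proof.
move=> cY F FF _.
have GY : (set_val @ F) Y.
  by apply: (@filterE _ F) => y; exact: set_valP.
have [p [Yp clp]] := cY (set_val @ F) (fmap_proper_filter set_val FF) GY.
exists (SigSub (mem_set Yp)); split => // A B FA.
rewrite nbhsE => -[W [[V oV <-] Vp] VB].
have GA : (set_val @ F) (set_val @` A).
  by apply: (@filterS _ F _ A) => // y Ay; exists y.
have [z [[y Ay yz] Vz]] : (set_val @` A) `&` V !=set0.
  by apply: clp => //; exact: open_nbhs_nbhs.
by exists y; split => //; apply: VB; rewrite /preimage /= yz.
Qed.

(** If the interiors missed a nonempty open set [V], then [V] would be covered
    by countably many closed sets that have no interior in it, against the
    Baire property. *)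
Lemma dense_bigcup_interior (X : topologicalType) (F : (set X)^nat) :
  baire_space X -> (forall n, closed (F n)) -> \bigcup_n F n = setT ->
  dense (\bigcup_n (F n)°).
Proof.
move=> baireX closedF coverF; apply: contrapT => /denseNE[V [[x0 [oV Vx0]]]].
move=> /disjoints_subset VF.
(* On [V] the [F n] have empty interior, so their complements are dense there;
   adding the exterior of [V] makes them dense everywhere. *)
pose U n := ~` F n `|` ~` closure V.
have oU n : open (U n).
  by apply: openU; apply: closed_openC => //; exact: closed_closure.
have dU n : dense (U n).
  move=> G [x Gx] oG.
  have [[z [Gz Vz]]|GV] := pselect (G `&` V !=set0).
    have /existsNP[w /not_implyP[[Gw Vw] Fw]] : ~ (G `&` V `<=` F n).
      move=> GVF; apply: (VF z Vz); exists n => //.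
      by apply: filterS GVF _; apply: open_nbhs_nbhs; split => //; exact: openI.
    by exists w; split => //; left.
  exists x; split => //; right => clVx; apply: GV.
  by rewrite setIC; apply: clVx; exact: open_nbhs_nbhs.
have [x [Vx Ux]] := baireX U oU dU V (ex_intro _ x0 Vx0) oV.
have [n _ Fx] : (\bigcup_n F n) x by rewrite coverF.
by case: (Ux n I) => //; apply; exact: subset_closure.
Qed.

Definition determined_by {P V W : Type} (f : P -> V) (g : nat -> P -> W) :=
  forall p q, (forall k, g k p = g k q) -> f p = f q.

(** A pointwise limit is determined by its approximants, so each step of the
    induction only has to merge countably many sequences into one. *)
Lemma baire_class_determined (R : realType) (P : topologicalType)
    (d : Order.disp_t) (I : orderType d) (a : I) (f : P -> R) :
  baire_class a f ->
  exists2 g : nat -> P -> R, (forall k, continuous (g k)) & determined_by f g.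
Proof.
elim=> [{}a {}f _ fc|{}a {}f b h _ _ IH fh].
  by exists (fun=> f) => // p q /(_ 0%N).
have /choice[G GP] n : exists g : nat -> P -> R,
    (forall k, continuous (g k)) /\ determined_by (h n) g.
  by have [g] := IH n; exists g.
(* The doubly indexed family [G n m] is listed along the codes of the pairs
   [(n, m)]; a constant fills the places of the numbers that code no pair. *)
exists (fun k => if @unpickle (nat * nat)%type k is Some nm
                 then G nm.1 nm.2 else cst 0).
  move=> k; case: unpickle => [nm|]; last exact: cst_continuous.
  exact: (GP nm.1).1.
move=> p q gpq.
suff hpq : h ^~ p = h ^~ q.
  rewrite -(cvg_lim (@Rhausdorff R) (fh p)) hpq.
  exact: (cvg_lim (@Rhausdorff R) (fh q)).
apply/funext => n; apply: (GP n).2 => m.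
by have := gpq (pickle (n, m)); rewrite pickleK.
Qed.

Lemma near_forall_leq (P : Type) (F : set_system P) (n : nat)
    (A : nat -> set P) : Filter F ->
  (forall k, (k <= n)%N -> \forall p \near F, A k p) ->
  \forall p \near F, forall k, (k <= n)%N -> A k p.
Proof.
move=> FF AF.
suff : \forall p \near F, forall i : 'I_n.+1, A i p.
  by apply: filterS => p Ap k kn; exact: (Ap (Ordinal (kn : (k < n.+1)%N))).
by apply: filter_forall => i; apply: AF; rewrite -ltnS.
Qed.

Section control.
Context {R : realType} {X Y : topologicalType}.
Variables (f : X * Y -> R) (g : nat -> X * Y -> R).

(** A single index [n] bounds both the number of functions compared and the
    precision, so that these relations form a countable base of the uniformity
    that the [g k (x, _)] induce on [Y]. *)
Definition close_values (n : nat) (x : X) (y y' : Y) :=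
  forall k, (k <= n)%N -> `|g k (x, y) - g k (x, y')| < n.+1%:R^-1.

Definition controlled (e : R) (n : nat) : set X :=
  [set x | forall y y', close_values n x y y' -> `|f (x, y) - f (x, y')| <= e].

Hypothesis (fc : separately_continuous f) (gc : forall k, continuous (g k)).

(** For fixed [y] and [y'], the premise of [controlled] is an open condition on
    [x] and its conclusion a closed one. *)
Lemma closed_controlled e n : closed (controlled e n).
Proof.
move=> x clx y y' cxy.
have gx k (y0 : Y) : g k (x', y0) @[x' --> x] --> g k (x, y0).
  apply: (@cvg_comp _ _ _ (fun x' => (x', y0)) (g k)); last exact: gc.
  by apply: cvg_pair => //=; exact: cvg_cst.
have near_close : \forall x' \near x, close_values n x' y y'.
  apply: near_forall_leq => k kn.
  apply: (@cvgr_lt _ _ _ _ (fun x' => `|g k (x', y) - g k (x', y')|)).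
    by apply: cvg_norm; exact: (cvgB (gx k y) (gx k y')).
  exact: cxy.
rewrite leNgt; apply/negP => egt.
have near_gt : \forall x' \near x, e < `|f (x', y) - f (x', y')|.
  apply: (@cvgr_gt _ _ _ _ (fun x' => `|f (x', y) - f (x', y')|)) egt.
  by apply: cvg_norm; exact: (cvgB (fc.2 y x) (fc.2 y' x)).
have [x' [cx' [/cx' ? ?]]] := clx _ (filterI near_close near_gt).
by lra.
Qed.

Hypothesis (cY : compact [set: Y]) (fg : determined_by f g).

(** Every pair [(y, y')] has a neighbourhood on which the implication defining
    [controlled e n] holds for all large [n], either because its conclusion
    holds there or because its premise fails; compactness of [Y * Y] makes [n]
    uniform. *)
Lemma bigcup_controlled (e : R) : 0 < e -> \bigcup_n controlled e n = setT.
Proof.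
move=> e0; apply/seteqP; split => // x _.
have fx (y y' : Y) : `|f (x, z.1) - f (x, z.2)| @[z --> (y, y')]
    --> `|f (x, y) - f (x, y')|.
  apply: cvg_norm; apply: cvgB.
    apply: (@cvg_comp _ _ _ fst (fun z => f (x, z))) (fc.1 x y).
    exact: cvg_fst.
  apply: (@cvg_comp _ _ _ snd (fun z => f (x, z))) (fc.1 x y').
  exact: cvg_snd.
have gx k (y y' : Y) : `|g k (x, z.1) - g k (x, z.2)| @[z --> (y, y')]
    --> `|g k (x, y) - g k (x, y')|.
  apply: cvg_norm; apply: cvgB.
    apply: (@cvg_comp _ _ _ (fun z : Y * Y => (x, z.1)) (g k)); last exact: gc.
    by apply: cvg_pair; [exact: cvg_cst|exact: cvg_fst].
  apply: (@cvg_comp _ _ _ (fun z : Y * Y => (x, z.2)) (g k)); last exact: gc.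
  by apply: cvg_pair; [exact: cvg_cst|exact: cvg_snd].
have /compact_near_coveringP cYY := compact_setX cY cY.
have [|N _ /(_ N (leqnn N)) HN] := cYY nat \oo (fun n z =>
  close_values n x z.1 z.2 -> `|f (x, z.1) - f (x, z.2)| <= e) _.
  move=> [y y'] _.
  (* If no [g k] separates [y] from [y'], neither does [f]; by continuity the
     conclusion then holds near [(y, y')].  If [g k] separates them, its values
     stay more than half their distance apart near [(y, y')], which falsifies
     the premise as soon as [1 / (n + 1)] is below that half. *)
  have [geq|/existsNP[k /eqP gneq]] :=
      pselect (forall k, g k (x, y) = g k (x, y')).
    have fz : \forall z \near (y, y'), `|f (x, z.1) - f (x, z.2)| < e.
      by apply: cvgr_lt (fx y y') _ _; rewrite (fg _ _ geq) subrr normr0.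
    exists ([set z | `|f (x, z.1) - f (x, z.2)| < e], setT).
      by split; [exact: fz|exact: filterT].
    by move=> [z n] [/= fzlt _] _; exact: ltW.
  pose c := `|g k (x, y) - g k (x, y')| / 2.
  have c0 : 0 < c by rewrite divr_gt0// normr_gt0 subr_eq0.
  have gz : \forall z \near (y, y'), c < `|g k (x, z.1) - g k (x, z.2)|.
    by apply: cvgr_gt (gx k y y') _ _; move: c0; rewrite /c; lra.
  have n_large := filterI (near_infty_natSinv_lt (PosNum c0)) (nbhs_infty_ge k).
  exists ([set z | c < `|g k (x, z.1) - g k (x, z.2)|],
          [set n | n.+1%:R^-1 < c /\ (k <= n)%N]).
    by split; [exact: gz|exact: n_large].
  move=> [z n] [/= cz [nc kn]] /(_ k kn) /lt_trans /(_ nc) /(lt_trans cz).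
  by rewrite ltxx.
by exists N => // y y' cl; exact: (HN (y, y')).
Qed.

(** At an interior point [x0] of [controlled e n], the bound on
    [|f (x, y) - f (x, y0)|] holds for all [x] near [x0] at once; this
    uniformity in [x] is what turns separate into joint continuity. *)
Lemma namioka_of_determined : baire_space X -> namioka_property f.
Proof.
move=> baireX.
pose U m := \bigcup_n (controlled m.+1%:R^-1 n)°.
have oU m : open (U m) by apply: bigcup_open => n _; exact: open_interior.
exists (\bigcap_m U m); split; last 1 first.
- move=> x0 y0 Ux0; apply/cvgrPdist_lt => e e0.
  have e20 : 0 < e / 2 by rewrite divr_gt0.
  have [m _ /(_ m (leqnn m)) me] := near_infty_natSinv_lt (PosNum e20).
  have {Ux0}[n _ x0n] := Ux0 m I.
  have fx0 : f (x, y0) @[x --> x0] --> f (x0, y0) := fc.2 y0 x0.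
  (* [g k z] and [g k (z.1, y0)] are compared through [g k (x0, y0)], hence
     the half of the precision required by [close_values n]. *)
  have n20 : 0 < n.+1%:R^-1 / 2 :> R by rewrite divr_gt0// invr_gt0.
  have gx0 k : g k (z.1, y0) @[z --> (x0, y0)] --> g k (x0, y0).
    apply: (@cvg_comp _ _ _ (fun z : X * Y => (z.1, y0)) (g k)); last exact: gc.
    by apply: cvg_pair; [exact: cvg_fst|exact: cvg_cst].
  have fz0 : f (z.1, y0) @[z --> (x0, y0)] --> f (x0, y0).
    by apply: (@cvg_comp _ _ _ fst (fun x => f (x, y0))) fx0; exact: cvg_fst.
  have near_f := (cvgrPdist_lt _ _).1 fz0 _ e20.
  have near_x : \forall z \near (x0, y0), controlled m.+1%:R^-1 n z.1.
    exact: (@cvg_fst _ _ (nbhs x0) (nbhs y0) _ _ x0n).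
  have near_g : \forall z \near (x0, y0), forall k, (k <= n)%N ->
      `|g k (x0, y0) - g k z| < n.+1%:R^-1 / 2.
    by apply: (@near_forall_leq _ (nbhs (x0, y0))) => k _;
      exact: (cvgrPdist_lt _ _).1 (gc k _) _ n20.
  have near_g0 : \forall z \near (x0, y0), forall k, (k <= n)%N ->
      `|g k (x0, y0) - g k (z.1, y0)| < n.+1%:R^-1 / 2.
    by apply: (@near_forall_leq _ (nbhs (x0, y0))) => k _;
      exact: (cvgrPdist_lt _ _).1 (gx0 k) _ n20.
  near=> z.
  have gz : forall k, (k <= n)%N -> `|g k (x0, y0) - g k z| < n.+1%:R^-1 / 2.
    by near: z.
  have gz0 : forall k, (k <= n)%N ->
      `|g k (x0, y0) - g k (z.1, y0)| < n.+1%:R^-1 / 2.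
    by near: z.
  have : `|f z - f (z.1, y0)| <= m.+1%:R^-1.
    have zn : controlled m.+1%:R^-1 n z.1 by near: z.
    rewrite [z in f z]surjective_pairing; apply: zn => k kn.
    rewrite -surjective_pairing.
    apply: le_lt_trans (ler_distD (g k (x0, y0)) _ _) _.
    by rewrite [ltRHS]splitr ltrD ?gz0// distrC gz.
  rewrite distrC => /le_lt_trans /(_ me) fzz.
  apply: le_lt_trans (ler_distD (f (z.1, y0)) _ _) _.
  rewrite [ltRHS]splitr; apply: ltrD fzz.
  by near: z; exact: near_f.
- apply: (baireX) => // m; apply: dense_bigcup_interior => // [n|].
    exact: closed_controlled.
  by apply: bigcup_controlled; rewrite invr_gt0.
- by exists U.
Unshelve. all: by end_near. Qed.

End control.

Theorem theorem5p3 (R : realType) (X : topologicalType) (T : Type)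
    (Y : set {ptws T -> R}) (f : X * set_type Y -> R) :
  baire_space X -> compact Y ->
  separately_continuous f -> baire_measurable f ->
  namioka_property f.
Proof.
move=> baireX /compact_set_type cY fc [d [I [a [_ _ /baire_class_determined]]]].
by move=> [g gc fg]; exact: namioka_of_determined fc gc cY fg baireX.
Qed.
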